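(* Consider the dataset with three examples $a,b,c$ and two weak hypotheses whose feature matrix is $$\mathbf M=\begin{pmatrix}+1&-1\\-1&+1\\+1&+1\end{pmatrix}$$ (rows $a,b,c$). For any $0<\varepsilon<1/3$, AdaBoost takes at least $2/(9\varepsilon)$ rounds to get within $\varepsilon$ of the optimal loss on this dataset; that is, for every run of AdaBoost on $\mathbf M$, if $L(\lambda^T)\le\inf_{\lambda\in\mathbb R^2}L(\lambda)+\varepsilon$ then $T\ge 2/(9\varepsilon)$.
   Context: For a feature matrix $\mathbf M$ with $m$ rows and $N$ columns (here $m=3$, $N=2$), the exponential loss of $\lambda\in\mathbb R^N$ is $L(\lambda)=\frac1m\sum_{i=1}^m e^{-(\mathbf M\lambda)_i}$. AdaBoost: start with $\lambda^0=0$. In round $t=1,2,\dots$, let $D_t(i)=e^{-(\mathbf M\lambda^{t-1})_i}/\sum_{k=1}^m e^{-(\mathbf M\lambda^{t-1})_k}$, choose a column $j_t$ maximizing $\left|\sum_i D_t(i)M_{ij}\right|$ over $j$ (ties broken arbitrarily), put $r_t=\sum_i D_t(i)M_{ij_t}$ and $\alpha_t=\frac12\ln\frac{1+r_t}{1-r_t}$, and set $\lambda^t=\lambda^{t-1}+\alpha_t\mathbf e_{j_t}$, where $\mathbf e_j$ is the $j$-th standard basis vector. *)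

(* Defs.v *)
From HB Require Import structures.
From mathcomp Require Import all_boot all_order all_algebra.
From mathcomp Require Import all_classical all_reals all_analysis.

Set Implicit Arguments.
Unset Strict Implicit.
Unset Printing Implicit Defensive.

Import Order.TTheory GRing.Theory Num.Theory.
Local Open Scope classical_set_scope.
Local Open Scope ring_scope.

Section AdaBoost.
Context {R : realType} {m N : nat}.
Implicit Types (M : 'M[R]_(m, N)) (lambda : 'cV[R]_N).

Definition exp_loss M lambda : R :=
  m%:R^-1 * \sum_(i < m) expR (- (M *m lambda) i 0).

Definition ada_dist M lambda (i : 'I_m) : R :=
  expR (- (M *m lambda) i 0) / \sum_(k < m) expR (- (M *m lambda) k 0).

Definition edge M lambda (j : 'I_N) : R :=
  \sum_(i < m) ada_dist M lambda i * M i j.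

Definition step_size (r : R) : R := 2^-1 * ln ((1 + r) / (1 - r)).

(* A relation rather than a function, as ties between columns are broken
   arbitrarily, possibly differently in each round. *)
Definition ada_round M lambda lambda' : Prop :=
  exists2 j : 'I_N,
    forall k : 'I_N, `|edge M lambda k| <= `|edge M lambda j| &
    lambda' = lambda + step_size (edge M lambda j) *: delta_mx j 0.

(* [lambda t] is the combination obtained after [t] rounds. *)
Definition ada_run M (lambda : nat -> 'cV[R]_N) : Prop :=
  lambda 0%N = 0 /\ forall t : nat, ada_round M (lambda t) (lambda t.+1).

End AdaBoost.

Definition abc_mx (R : realType) : 'M[R]_(3, 2) :=
  \matrix_(i < 3, j < 2)
    (nth [::] [:: [:: 1; -1];
                  [:: -1; 1];
                  [:: 1; 1]] i)`_j.

(* Main.v *)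
Require Import Defs.
From mathcomp Require Import all_boot all_order all_algebra.
From mathcomp Require Import all_classical all_reals all_analysis.
From mathcomp Require Import ring lra.

(** The sum of the three unnormalized weights [a], [b], [c] of the examples is
    three times the loss, and [a * b = 1] always, as the first two rows of the
    matrix are opposite.  This is enough to solve the dynamics in closed form.

    A round makes the edge of the chosen column vanish, so the next round must
    choose the other column: after the first round the columns alternate.  If
    the first column was chosen last, its edge [a - b + c] is [0], and the next
    round turns the larger weight [b] into a new larger weight [a'] with
    [a' ^+ 2 = a * (b + c) = 2 - b ^- 2].  Starting from [b ^+ 2 = 2] after one
    round, the square of the larger weight after [t] rounds is [(t + 1) / t]
    ([alternation_step], [run_alternating]).  By the vanishing edge, the loss
    is then [2 / 3 * sqrt (1 + 1 / t)].

    The infimum of the loss is [2 / 3] ([inf_loss_le]), approached along the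
    diagonal without being attained.  The excess [2 / 3 * (sqrt (1 + 1 / t) - 1)]
    decays only like [1 / t]: as [sqrt] is concave, it is at least
    [2 / 3 * (sqrt 2 - 1) / t], and [2 / 3 * (sqrt 2 - 1) > 2 / 9]. *)

Set Implicit Arguments.
Unset Strict Implicit.
Unset Printing Implicit Defensive.

Import Order.TTheory GRing.Theory Num.Theory.
Local Open Scope classical_set_scope.
Local Open Scope ring_scope.

Section AdaBoostWeights.
Context {R : realType}.
Implicit Types (lambda : 'cV[R]_2) (a b c e r : R).

Definition weight lambda (i : 'I_3) : R :=
  expR (- (abc_mx R *m lambda) i 0).

Lemma weight_gt0 lambda i : 0 < weight lambda i.
Proof. exact: expR_gt0. Qed.

Lemma abc_mulE lambda :
  [/\ (abc_mx R *m lambda) 0 0 = lambda 0 0 - lambda 1 0,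
      (abc_mx R *m lambda) 1 0 = lambda 1 0 - lambda 0 0 &
      (abc_mx R *m lambda) 2 0 = lambda 0 0 + lambda 1 0].
Proof.
have l1 : lift ord0 (ord0 : 'I_1) = 1 :> 'I_2 by apply/val_inj.
by split; rewrite !mxE !big_ord_recl big_ord0 !mxE /= l1; ring.
Qed.

Lemma sum3E (F : 'I_3 -> R) : \sum_(i < 3) F i = F 0 + F 1 + F 2.
Proof.
rewrite !big_ord_recl big_ord0 addr0 addrA.
by congr (F _ + F _ + F _); apply/val_inj.
Qed.

Lemma lossE lambda : exp_loss (abc_mx R) lambda =
  3^-1 * (weight lambda 0 + weight lambda 1 + weight lambda 2).
Proof. by rewrite /exp_loss sum3E. Qed.

Lemma weightM lambda : weight lambda 0 * weight lambda 1 = 1.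
Proof.
rewrite /weight -expRD; have [-> -> _] := abc_mulE lambda.
by rewrite (_ : _ + _ = 0) ?expR0//; ring.
Qed.

Lemma edge0E lambda : edge (abc_mx R) lambda 0 =
  (weight lambda 0 - weight lambda 1 + weight lambda 2) /
  (weight lambda 0 + weight lambda 1 + weight lambda 2).
Proof. by rewrite /edge /ada_dist !sum3E -!/(weight _ _) !mxE /=; ring. Qed.

Lemma edge1E lambda : edge (abc_mx R) lambda 1 =
  (weight lambda 1 - weight lambda 0 + weight lambda 2) /
  (weight lambda 0 + weight lambda 1 + weight lambda 2).
Proof. by rewrite /edge /ada_dist !sum3E -!/(weight _ _) !mxE /=; ring. Qed.

Lemma sqr_expR_step_size r : -1 < r < 1 ->
  expR (step_size r) ^+ 2 = (1 + r) / (1 - r).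
Proof.
move=> /andP[r1 r2]; rewrite /step_size -expRM_natl.
rewrite mulrA divff// mul1r lnK// posrE divr_gt0//; lra.
Qed.

(** With [p] and [q] the total weights of the rows where a column is [1] and
    [-1], the edge of the column is [(p - q) / (p + q)], and a step divides [p]
    and multiplies [q] by [sqrt (p / q)]; so both become [sqrt (p * q)]. *)
Lemma sqr_expR_step_size_ratio p q : 0 < p -> 0 < q ->
  expR (step_size ((p - q) / (p + q))) ^+ 2 = p / q :> R.
Proof.
move=> p0 q0; have pq0 : 0 < p + q by lra.
rewrite sqr_expR_step_size; last first.
  by rewrite ltr_pdivlMr// ltr_pdivrMr//; apply/andP; split; lra.
by field; apply/and3P; split; lra.
Qed.

Lemma weight_step0 lambda (s : R) :
  let w := weight (lambda + s *: delta_mx 0 0) in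
  [/\ w 0 = weight lambda 0 / expR s, w 1 = weight lambda 1 * expR s &
      w 2 = weight lambda 2 / expR s].
Proof.
rewrite /weight -!expRN -!expRD.
have [-> -> ->] := abc_mulE lambda.
have [-> -> ->] := abc_mulE (lambda + s *: delta_mx 0 0).
by rewrite !mxE /=; split; congr expR; ring.
Qed.

Lemma weight_step1 lambda (s : R) :
  let w := weight (lambda + s *: delta_mx 1 0) in
  [/\ w 0 = weight lambda 0 * expR s, w 1 = weight lambda 1 / expR s &
      w 2 = weight lambda 2 / expR s].
Proof.
rewrite /weight -!expRN -!expRD.
have [-> -> ->] := abc_mulE lambda.
have [-> -> ->] := abc_mulE (lambda + s *: delta_mx 1 0).
by rewrite !mxE /=; split; congr expR; ring.
Qed.

(** A round in terms of weights only.  The edges are compared through their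
    numerators, since they share the total weight as denominator. *)
Variant round_spec lambda (w : 'I_3 -> R) : Prop :=
| Round0 e of
    `|weight lambda 1 - weight lambda 0 + weight lambda 2| <=
      `|weight lambda 0 - weight lambda 1 + weight lambda 2| &
    0 < e & e ^+ 2 = (weight lambda 0 + weight lambda 2) / weight lambda 1 &
    w 0 = weight lambda 0 / e & w 1 = weight lambda 1 * e &
    w 2 = weight lambda 2 / e
| Round1 e of
    `|weight lambda 0 - weight lambda 1 + weight lambda 2| <=
      `|weight lambda 1 - weight lambda 0 + weight lambda 2| &
    0 < e & e ^+ 2 = (weight lambda 1 + weight lambda 2) / weight lambda 0 &
    w 0 = weight lambda 0 * e & w 1 = weight lambda 1 / e &
    w 2 = weight lambda 2 / e.

Lemma roundP lambda lambda' :
  ada_round (abc_mx R) lambda lambda' -> round_spec lambda (weight lambda').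
Proof.
have := (weight_gt0 lambda 0, weight_gt0 lambda 1, weight_gt0 lambda 2).
set a := weight lambda 0; set b := weight lambda 1; set c := weight lambda 2.
move=> [[a0 b0] c0]; have Z0 : 0 < a + b + c by lra.
have cmp p q : (`|p / (a + b + c)| <= `|q / (a + b + c)|) = (`|p| <= `|q|).
  by rewrite !normrM ler_pM2r// normr_gt0 invr_neq0// gt_eqF.
case=> j jmax ->; have j01 : j = 0 \/ j = 1.
  by case: j {jmax} => [[|[|//]] ?]; [left|right]; apply/val_inj.
case: j01 jmax => -> jmax.
- have [w0 w1 w2] := weight_step0 lambda (step_size (edge (abc_mx R) lambda 0)).
  apply: Round0 (expR_gt0 _) _ w0 w1 w2.
    by have := jmax 1; rewrite edge0E edge1E cmp.
  rewrite edge0E -/a -/b -/c (_ : _ / _ = (a + c - b) / (a + c + b)).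
    by rewrite sqr_expR_step_size_ratio//; lra.
  by congr (_ / _); ring.
- have [w0 w1 w2] := weight_step1 lambda (step_size (edge (abc_mx R) lambda 1)).
  apply: Round1 (expR_gt0 _) _ w0 w1 w2.
    by have := jmax 0; rewrite edge0E edge1E cmp.
  rewrite edge1E -/a -/b -/c (_ : _ / _ = (b + c - a) / (b + c + a)).
    by rewrite sqr_expR_step_size_ratio//; lra.
  by congr (_ / _); ring.
Qed.

(** The weights after [t] rounds when the last chosen column is correct on the
    examples of weights [a] and [c]: the equation [a + c = b] says that its
    edge vanishes.  As [a * b = 1], the three weights are determined. *)
Definition alternating (t : nat) a b c : Prop :=
  a + c = b /\ b ^+ 2 = t.+1%:R / t%:R.

(** The square of the larger weight evolves by [x |-> 2 - 1 / x], and this maps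
    [(t + 1) / t] to [(t + 2) / (t + 1)]. *)
Lemma alternation_step t a b c e : 0 < a -> 0 < b -> 0 < e -> (0 < t)%N ->
  a * b = 1 -> e ^+ 2 = (b + c) / a ->
  alternating t a b c -> alternating t.+1 (b / e) (a * e) (c / e).
Proof.
move=> a0 b0 e0 t0 ab1 e2 [acb b2].
have t0R : 0 < t%:R :> R by rewrite ltr0n.
split.
  rewrite -mulrDl; apply: (mulIf (lt0r_neq0 e0)).
  rewrite divfK ?gt_eqF// -mulrA -expr2 e2; field; lra.
have a2 : a ^+ 2 = t%:R / t.+1%:R.
  have -> : a = b^-1 by apply: (mulIf (lt0r_neq0 b0)); rewrite ab1 mulVf ?gt_eqF.
  by rewrite exprVn b2 invf_div.
have -> : (a * e) ^+ 2 = 2 * (a * b) - a ^+ 2.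
  rewrite exprMn e2 -acb; field; lra.
by rewrite ab1 a2 -!natr1; field; lra.
Qed.

(** The column used last has edge [0] while the other one has a positive edge,
    so the same column is never chosen twice in a row. *)
Lemma edge0_not_max a b c : 0 < c -> a + c = b ->
  ~ `|b - a + c| <= `|a - b + c|.
Proof.
move=> c0 <-; rewrite (_ : a - _ + c = 0) ?normr0 ?normr_le0; last by ring.
move=> /eqP; lra.
Qed.

Lemma run_alternating (lambda : nat -> 'cV[R]_2) t :
  ada_run (abc_mx R) lambda ->
  let w := weight (lambda t.+1) in
  alternating t.+1 (w 0) (w 1) (w 2) \/ alternating t.+1 (w 1) (w 0) (w 2).
Proof.
case=> l0 rounds; elim: t => [|t IH] /=.
  have w1 i : weight (lambda 0%N) i = 1.
    by rewrite /weight l0 mulmx0 mxE oppr0 expR0.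
  clear l0; case: (roundP (rounds 0%N)); rewrite !w1 => e _ e0 e2 -> -> ->;
    [left|right]; split; rewrite !mul1r ?e2 ?divr1//;
    apply: (mulIf (lt0r_neq0 e0)); rewrite -expr2 e2; field; lra.
clear l0; have ab1 := weightM (lambda t.+1).
have ba1 : weight (lambda t.+1) 1 * weight (lambda t.+1) 0 = 1 by rewrite mulrC.
have a0 := weight_gt0 (lambda t.+1) 0.
have b0 := weight_gt0 (lambda t.+1) 1.
have c0 := weight_gt0 (lambda t.+1) 2.
case: IH => alt; case: (roundP (rounds t.+1)) => e emax e0 e2 -> -> ->.
- by case: (edge0_not_max c0 (proj1 alt) emax).
- by right; exact: alternation_step e0 _ ab1 e2 alt.
- by left; exact: alternation_step e0 _ ba1 e2 alt.
- by case: (edge0_not_max c0 (proj1 alt) emax).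
Qed.

(** On the diagonal [(x, x)] the first two examples have weight [1], and the
    third has weight [expR (- 2 x)], which takes every positive value. *)
Lemma inf_loss_le : inf (range (exp_loss (abc_mx R))) <= 2 / 3.
Proof.
apply/ler_addgt0Pl => d d0.
pose lambda : 'cV[R]_2 := const_mx (- ln (3 * d) / 2).
have -> : d + 2 / 3 = exp_loss (abc_mx R) lambda.
  rewrite lossE /weight; have [-> -> ->] := abc_mulE lambda; rewrite !mxE.
  rewrite subrr oppr0 expR0 (_ : - (_ + _) = ln (3 * d)); last by field.
  by rewrite lnK ?posrE; [field|lra].
apply: ge_inf; last by exists lambda.
exists 0 => _ [l _ <-]; rewrite lossE.
have := (weight_gt0 l 0, weight_gt0 l 1, weight_gt0 l 2) => -[[]]; lra.
Qed.

Lemma loss_alternating (lambda : nat -> 'cV[R]_2) t :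
  ada_run (abc_mx R) lambda ->
  exists2 u, 0 < u /\ u ^+ 2 = t.+2%:R / t.+1%:R &
    exp_loss (abc_mx R) (lambda t.+1) = 2 / 3 * u.
Proof.
move=> run; rewrite lossE.
case: (run_alternating t run) => -[eq0 sq].
- by exists (weight (lambda t.+1) 1); [split=> //; exact: weight_gt0|lra].
- by exists (weight (lambda t.+1) 0); [split=> //; exact: weight_gt0|lra].
Qed.

End AdaBoostWeights.

Theorem lemma31 (R : realType) (eps : R) (lambda : nat -> 'cV[R]_2) (T : nat)
    (eps_gt0 : 0 < eps) (eps_lt : eps < 1 / 3)
    (run : ada_run (abc_mx R) lambda)
    (near_opt : exp_loss (abc_mx R) (lambda T)
      <= inf (range (exp_loss (abc_mx R))) + eps) :
  2 / (9 * eps) <= T%:R.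
Proof.
have {near_opt} le_loss : exp_loss (abc_mx R) (lambda T) <= 2 / 3 + eps.
  by apply: le_trans near_opt _; rewrite lerD2r inf_loss_le.
case: T le_loss => [|t].
  (* The initial loss is 1, and 1 > 2 / 3 + eps. *)
  rewrite lossE /weight (proj1 run) mulmx0 !mxE oppr0 expR0; lra.
have [u [u0 u2] ->] := loss_alternating t run => le_u.
have t0 : 0 < t.+1%:R :> R by rewrite ltr0n.
rewrite ler_pdivrMr ?mulr_gt0//.
have {}u2 : t.+1%:R * u ^+ 2 = t.+1%:R + 1.
  by rewrite u2 natr1 mulrC divfK ?gt_eqF.
(* u <= 1 + 3 eps / 2 and eps < 1 / 3 give 1 / T = u ^+ 2 - 1 <= 15 eps / 4,
   slightly better than the required 9 eps / 2. *)
have u2_le : u ^+ 2 <= 1 + 15 / 4 * eps by nra.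
nra.
Qed.
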